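(* Let $(X,\|\cdot\|)$ be a Banach space and $C\subseteq X$ a closed convex set. Let $T_n:C\to C$ $(n\ge1)$ be nonexpansive maps converging uniformly to $T:C\to C$, and let $\rho_n=\sup\{\|T_nx-Tx\|:x\in C\}$, so that $\rho_n\to0$. Let $(\alpha_n)_{n\ge1}$ be a sequence in $[0,1]$, $x_0\in C$, and let $(x_n)_{n\in\mathbb{N}}$ be generated by $$x_{n+1}=(1-\alpha_{n+1})x_n+\alpha_{n+1}T_{n+1}x_n,\qquad n\in\mathbb{N}.$$ Suppose that $\sum_{k\ge1}\alpha_k\rho_k<\infty$, $\sum_{k\ge1}\alpha_k(1-\alpha_k)=\infty$, and that for some $\kappa\ge0$ one has $\|x_0-Tx_n\|\le\kappa$ for all $n\in\mathbb{N}$. Then $\|x_n-Tx_n\|\to0$ and, for all $n\in\mathbb{N}$, $$\|x_n-Tx_n\|\le\kappa\,\sigma(\tau_n)+\sum_{i=1}^n2\alpha_i\rho_i\,\sigma(\tau_n-\tau_i)+2\rho_{n+1}.$$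
   Context: $\mathbb{N}=\{0,1,2,\dots\}$. A map $S$ is nonexpansive if $\|Sx-Sy\|\le\|x-y\|$ for all $x,y$ in its domain. $\tau_n=\sum_{k=1}^n\alpha_k(1-\alpha_k)$ (so $\tau_0=0$). The function $\sigma:[0,\infty)\to\mathbb{R}$ is $\sigma(y)=\min\{1,1/\sqrt{\pi y}\}$, with $\sigma(0)=1$. *)

(* Defs.v *)
From HB Require Import structures.
From mathcomp Require Import all_boot all_order all_algebra.
From mathcomp Require Import all_classical all_reals all_analysis.
Set Implicit Arguments.
Unset Strict Implicit.
Unset Printing Implicit Defensive.
Import Order.TTheory GRing.Theory Num.Theory.
Import numFieldNormedType.Exports.
Local Open Scope classical_set_scope.
Local Open Scope ring_scope.

Definition nonexpansive_on (R : realType) (X : normedModType R)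
    (C : set X) (S : X -> X) : Prop :=
  forall x y : X, C x -> C y -> `|S x - S y| <= `|x - y|.

(* The supremum is taken in the extended reals, where it always exists; a real
   [sup] would silently be 0 when the distances are unbounded on [C]. *)
Definition unif_dist (R : realType) (X : normedModType R)
    (C : set X) (S T : X -> X) : \bar R :=
  ereal_sup [set (`|S x - T x|)%:E | x in C].

Definition tau (R : realType) (alpha : nat -> R) (n : nat) : R :=
  \sum_(1 <= k < n.+1) alpha k * (1 - alpha k).

(* Meant for [0 <= y]; [0^-1] is [0], so the value at 0 is given apart. *)
Definition sigma (R : realType) (y : R) : R :=
  if y == 0 then 1 else Num.min 1 (Num.sqrt (pi * y))^-1.

(* Main.v *)
Require Import Defs.
From mathcomp Require Import all_boot all_order all_algebra.
From mathcomp Require Import all_classical all_reals all_analysis.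
From mathcomp Require Import measurable_realfun.
From mathcomp Require Import ring lra zify.
Import Order.TTheory GRing.Theory Num.Theory.
Import numFieldNormedType.Exports.
Local Open Scope classical_set_scope.
Local Open Scope ring_scope.

(** Put u(m, n) = |x_m - x_n| and v(m, n) = |x_m - T x_n| for m <= n. The
    iteration and the nonexpansiveness of T give the coupled inequalities
      u(m, n) <= (1 - a_n) u(m, n-1) + a_n v(m, n-1) + a_n rho_n   (m < n),
      v(m, n) <= (1 - a_m) v(m-1, n) + a_m u(m-1, n) + a_m rho_m   (0 < m),
    with u(n, n) = 0 and v(0, n) <= kappa, where a_n stands for alpha_n.

    They are solved by a race. A pursuer starts at level n and a runner at level
    m, and both go down to level 0. At level k they toss independent coins F_k
    and H_k of bias a_k and jump on success. The lead is the number of jumps of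
    the pursuer minus that of the runner; it increases by F_k at the levels
    above m, changes by F_k - H_k from level m on, and is then killed at 0.
    Going down from level m to level i, the lead performs a lazy symmetric
    walk; let h^i_m(d) be the probability that it stays positive when it starts
    at d. Then u(m, n) is at most the bound below with d = 0, and v(m, n) with
    d = 1:
      kappa E h^0_m(d + F) + sum_(0 < i <= m) 2 a_i rho_i E h^i_m(d + F)
        + sum_(m < i <= n) a_i rho_i,    F = F_(m+1) + ... + F_n.
    The factor 2 appears because the error made at level i is paid once by the
    pursuer and once by the runner (race_bound_ge). For m = n and d = 1 this is
      |x_n - T x_n| <= kappa h^0_n(1) + sum_(0 < i <= n) 2 a_i rho_i h^i_n(1).

    It remains to see that h^i_n(1) <= sigma(tau_n - tau_i). Since the walk is
    killed at 0, the reflection principle expresses h by a Fourier integral: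
      h^i_m(d) = (2 / pi) int_0^(pi/2) w(t) D_d(t) dt,
      w(t) = prod_(i < k <= m) (1 - 4 a_k (1 - a_k) sin^2 t),
    where D_d is the sum of cos(2 j t) over -d < j <= d (survival_mean). For
    m = n, as D_1 = 2 cos^2 t <= 2 cos t and
    w(t) <= exp(- 4 (tau_n - tau_i) sin^2 t), the substitution u = sin t bounds
    h^i_n(1) by a Gaussian integral equal to 1 / sqrt (pi (tau_n - tau_i))
    (survival_le_sqrt).

    The term 2 rho_(n+1) is not needed. Convergence to 0 follows from the bound
    by splitting the sum: the a_i rho_i are summable, and each
    sigma(tau_n - tau_i) tends to 0 because tau_n tends to infinity
    (sum_sigma_cvg0). *)

(** * The race and its recursion *)

(** Indicator of a positive lead. *)
Definition alive {R : realType} (d : nat) : R := (0 < d)%N%:R.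

(** Average of [g] over one toss of a coin of bias [b] that increases the
    argument by one on success. *)
Definition coin {R : realType} (b : R) (g : nat -> R) (d : nat) : R :=
  (1 - b) * g d + b * g d.+1.

(** One step of the lazy symmetric walk killed at 0, acting on functions of the
    lead: an independent pair of coins of bias [b] moves the lead by +1, 0 or -1
    with probabilities [b * (1 - b)], [(1 - b) ^+ 2 + b ^+ 2], [b * (1 - b)]. *)
Definition lazy_step {R : realType} (b : R) (g : nat -> R) (d : nat) : R :=
  if d is e.+1 then (1 - b) * coin b g e.+1 + b * coin b g e else 0.

(** [survival a i m d] is the probability that the walk started at [d] and
    driven by the coins of levels [m, m - 1, ..., i + 1] stays positive. For
    [m <= i] no coin is tossed. *)
Fixpoint survival {R : realType} (a : nat -> R) (i m : nat) : nat -> R :=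
  if m is p.+1 then
    if (i <= p)%N then lazy_step (a m) (survival a i p) else alive
  else alive.

(** [lead a m k g d] is the expectation of [g (d + F)], where [F] counts the
    successes of the coins of levels [m + 1, ..., m + k]. *)
Fixpoint lead {R : realType} (a : nat -> R) (m k : nat) (g : nat -> R) :
    nat -> R :=
  if k is p.+1 then coin (a (m + k)%N) (lead a m p g) else g.

Section recursion.
Context {R : realType}.
Implicit Types (a e : nat -> R) (g : nat -> R) (b kappa : R).

Lemma survivalSn a i m : (i <= m)%N ->
  survival a i m.+1 = lazy_step (a m.+1) (survival a i m).
Proof. by move=> im /=; rewrite im. Qed.

Lemma survival_id a m : survival a m m = alive.
Proof. by case: m => //= m; rewrite ltnn. Qed.

Lemma survival0 a i m : survival a i m 0%N = 0.
Proof. by case: m => //= m; case: ifP. Qed.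

Lemma lead0 a m g : lead a m 0 g = g. Proof. by []. Qed.

Lemma leadSr a m k g :
  lead a m k.+1 g = coin (a (m + k.+1)%N) (lead a m k g).
Proof. by []. Qed.

(** Conditioning on the coin of lowest level instead of the highest one. *)
Lemma leadSl a m k g : lead a m k.+1 g = lead a m.+1 k (coin (a m.+1) g).
Proof.
elim: k => [|k IH] /=; first by rewrite addn1.
by rewrite [RHS]/= -IH /= addSnnS.
Qed.

Lemma lead_alive a m k d : lead a m k alive d.+1 = 1.
Proof.
by elim: k d => //= k IH d; rewrite /coin !IH !mulr1 subrK.
Qed.

Lemma lead_lazy_step a m k b g d :
  lead a m k (lazy_step b g) d.+1 =
  (1 - b) * lead a m k (coin b g) d.+1 + b * lead a m k (coin b g) d.
Proof. by elim: k d => //= k IH d; rewrite /coin !IH; ring. Qed.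

Lemma coin_itv01 b g : 0 <= b <= 1 -> (forall d, 0 <= g d <= 1) ->
  forall d, 0 <= coin b g d <= 1.
Proof.
by move=> ? g01 d; have := g01 d; have := g01 d.+1; rewrite /coin; nra.
Qed.

Lemma survival_itv01 a i m : (forall n, (1 <= n)%N -> 0 <= a n <= 1) ->
  forall d, 0 <= survival a i m d <= 1.
Proof.
move=> a01; have alive01 d : 0 <= alive d <= (1 : R).
  by rewrite /alive; case: (0 < d)%N; rewrite ?lexx ler01.
elim: m => //= m IH d; case: ifP => // _.
case: d => [|d] /=; first by rewrite lexx ler01.
have am := a01 m.+1 isT; have c01 := coin_itv01 _ _ am IH.
by have := c01 d; have := c01 d.+1; nra.
Qed.

Arguments survival {R} a i m d : simpl never.
Arguments lead {R} a m k g d : simpl never.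

(** The solution of the coupled recursion at the indices [m] and [m + k], with
    [d = 0] for distances between two iterates, [d = 1] for the distance from an
    iterate to an image, and [e i] for the error at level [i]. *)
Definition race_bound a e kappa (m k d : nat) : R :=
  kappa * lead a m k (survival a 0 m) d
  + \sum_(1 <= i < m.+1) 2 * e i * lead a m k (survival a i m) d
  + \sum_(m.+1 <= i < (m + k).+1) e i.

(** The three cases of the recursion, as equalities for [race_bound]. *)
Lemma race_bound00 a e kappa m : race_bound a e kappa m 0 0 = 0.
Proof.
rewrite /race_bound lead0 survival0 mulr0 add0r addn0 [X in _ + X]big_geq// addr0.
by apply: big1 => i _; rewrite lead0 survival0 mulr0.
Qed.

Lemma race_boundSr a e kappa m k d :
  race_bound a e kappa m k.+1 d =
  (1 - a (m + k.+1)%N) * race_bound a e kappa m k d +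
  a (m + k.+1)%N * race_bound a e kappa m k d.+1 + e (m + k.+1)%N.
Proof.
rewrite /race_bound leadSr /coin; set b := a _.
rewrite [X in _ + X = _](_ : _ = \sum_(m.+1 <= i < (m + k).+1) e i +
    e (m + k.+1)%N); last by rewrite addnS big_nat_recr//=; lia.
have -> : \sum_(1 <= i < m.+1) 2 * e i * lead a m k.+1 (survival a i m) d =
    (1 - b) * (\sum_(1 <= i < m.+1) 2 * e i * lead a m k (survival a i m) d) +
    b * (\sum_(1 <= i < m.+1) 2 * e i * lead a m k (survival a i m) d.+1).
  rewrite !mulr_sumr -big_split; apply: eq_bigr => i _.
  by rewrite leadSr /coin -/b /=; ring.
by rewrite /= !addnS; ring.
Qed.

Lemma race_boundSl a e kappa m k :
  race_bound a e kappa m.+1 k 1 =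
  (1 - a m.+1) * race_bound a e kappa m k.+1 1 +
  a m.+1 * race_bound a e kappa m k.+1 0 + e m.+1.
Proof.
rewrite /race_bound; set b := a m.+1.
have H i : (i <= m)%N -> lead a m.+1 k (survival a i m.+1) 1 =
   (1 - b) * lead a m k.+1 (survival a i m) 1 +
   b * lead a m k.+1 (survival a i m) 0.
  by move=> im; rewrite survivalSn// lead_lazy_step -!leadSl.
rewrite H// [X in _ + X + _ = _]big_nat_recr//= survival_id lead_alive mulr1.
have -> : \sum_(1 <= i < m.+1) 2 * e i * lead a m.+1 k (survival a i m.+1) 1 =
    (1 - b) * (\sum_(1 <= i < m.+1)
                 2 * e i * lead a m k.+1 (survival a i m) 1) +
    b * (\sum_(1 <= i < m.+1) 2 * e i * lead a m k.+1 (survival a i m) 0).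
  rewrite !mulr_sumr -big_split; apply: eq_big_nat => i /andP[_ im].
  by rewrite H//=; move: (lead _ _ _ _ 1%N) (lead _ _ _ _ 0%N) => p q; ring.
rewrite addnS [X in _ = _ * (_ + X) + _ + _]big_ltn; last by lia.
rewrite [X in _ = _ + _ * (_ + X) + _]big_ltn; last by lia.
rewrite addSn; ring.
Qed.

(** Comparison principle: [race_bound] dominates every solution of the coupled
    inequalities, [u m k] and [v m k] being indexed by the lower index and the
    gap. *)
Lemma race_bound_ge a e kappa (u v : nat -> nat -> R) :
  0 <= kappa ->
  (forall n, (1 <= n)%N -> 0 <= a n <= 1) ->
  (forall n, (1 <= n)%N -> 0 <= e n) ->
  (forall m, u m 0 <= 0) ->
  (forall m k, u m k.+1 <= (1 - a (m + k.+1)%N) * u m k +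
     a (m + k.+1)%N * v m k + e (m + k.+1)%N) ->
  (forall k, v 0%N k <= kappa) ->
  (forall m k, v m.+1 k <= (1 - a m.+1) * v m k.+1 +
     a m.+1 * u m k.+1 + e m.+1) ->
  forall m k, u m k <= race_bound a e kappa m k 0 /\
              v m k <= race_bound a e kappa m k 1.
Proof.
move=> kappa0 a01 e0 um0 umS v0 vS.
have uP m : (forall k, v m k <= race_bound a e kappa m k 1) ->
    forall k, u m k <= race_bound a e kappa m k 0.
  move=> vm; elim=> [|k IH]; first by rewrite race_bound00.
  rewrite race_boundSr (le_trans (umS _ _))// lerD2r.
  have /a01 : (1 <= m + k.+1)%N by rewrite addnS.
  by have := vm k; nra.
have vP m k : v m k <= race_bound a e kappa m k 1.
  elim: m k => [|m IH] k.
    rewrite /race_bound survival_id lead_alive mulr1.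
    rewrite [X in _ + X + _]big_geq// addr0 (le_trans (v0 k))// lerDl.
    by rewrite big_nat sumr_ge0// => i /andP[i1 _]; exact: e0.
  rewrite race_boundSl (le_trans (vS _ _))// lerD2r.
  by have := a01 m.+1 isT; have := IH k.+1; have := uP _ IH k.+1; nra.
by move=> m k; split=> //; exact: uP.
Qed.

End recursion.

(** * Fourier representation of the survival probability *)

Section kernel.
Context {R : realType}.
Implicit Types (f g : R -> R) (t : R).

(** Normalised integral over [0, pi / 2]. *)
Definition mean f : R :=
  2 / pi * \int[@lebesgue_measure R]_(t in `[0, pi / 2]) f t.

Lemma integrable_pihalf f : continuous f ->
  (@lebesgue_measure R).-integrable `[0, pi / 2] (EFin \o f).
Proof.
move=> cf; apply: continuous_compact_integrable; first exact: segment_compact.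
exact: continuous_subspaceT.
Qed.

Lemma meanD f g : continuous f -> continuous g ->
  mean (fun t => f t + g t) = mean f + mean g.
Proof.
move=> cf cg; rewrite /mean RintegralD ?mulrDr//; exact: integrable_pihalf.
Qed.

Lemma meanZ (c : R) f : continuous f -> mean (fun t => c * f t) = c * mean f.
Proof.
by move=> cf; rewrite /mean RintegralZl//; [ring|exact: integrable_pihalf].
Qed.

Lemma le_mean f g : continuous f -> continuous g ->
  (forall t, 0 <= t <= pi / 2 -> f t <= g t) -> mean f <= mean g.
Proof.
move=> cf cg fg; rewrite /mean ler_wpM2l ?divr_ge0 ?pi_ge0//.
apply: le_Rintegral => //; try exact: integrable_pihalf.
Qed.

Lemma mean1 : mean (fun=> 1) = 1.
Proof.
rewrite /mean Rintegral_cst//= lebesgue_measure_itv/= lte_fin divr_gt0 ?pi_gt0//.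
by rewrite oppr0 adde0 mul1r/= mulrA divfK ?divff// gt_eqF// pi_gt0.
Qed.

Lemma mean0 : mean (fun=> 0) = 0.
Proof. by rewrite /mean Rintegral_cst//= mul0r mulr0. Qed.

Lemma sin_pi_mul (n : nat) : sin (n%:R * pi) = 0 :> R.
Proof.
elim: n => [|n IH]; first by rewrite mul0r sin0.
by rewrite -natr1 mulrDl mul1r sinDpi IH oppr0.
Qed.

Lemma mean_cos (n : nat) : mean (fun t => cos (n.+1%:R * (2 * t))) = 0.
Proof.
pose N : R := n.+1%:R * 2.
have N0 : N != 0 by rewrite mulf_neq0.
have dF (t : R) : is_derive t 1 (fun t => N^-1 * sin (N * t)) (cos (N * t)).
  have -> : cos (N * t) = N^-1 * (N * cos (N * t)) by rewrite mulKf.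
  apply: is_deriveZ.
  have -> : N * cos (N * t) = cos (N * t) * N by rewrite mulrC.
  apply: is_derive1_comp.
  by have := is_deriveZ N (is_derive_id t (1 : R)); rewrite /GRing.scale/= mulr1.
have cN : continuous (fun t => cos (N * t)).
  move=> t; apply: continuous_comp; first exact: mulrl_continuous.
  exact: continuous_cos.
rewrite /mean.
rewrite (_ : (fun t => _) = fun t => cos (N * t)); last first.
  by apply/funext => t; rewrite mulrA.
rewrite /Rintegral (continuous_FTC2 (F := fun t => N^-1 * sin (N * t)))//.
- have -> : N * (pi / 2) = n.+1%:R * pi.
    by rewrite /N -mulrA [2 * _]mulrCA divff// mulr1.
  by rewrite sin_pi_mul !mulr0 sin0 mulr0 sube0/= mulr0.
- by rewrite divr_gt0 ?pi_gt0.
- exact: continuous_subspaceT.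
- have cF : continuous (fun t => N^-1 * sin (N * t)).
    by move=> t; apply/differentiable_continuous/derivable1_diffP.
  split; first by move=> t _.
    by apply: cvg_at_right_filter; exact: cF.
  by apply: cvg_at_left_filter; exact: cF.
- by move=> t _; rewrite derive1E; exact: derive_val.
Qed.

(** The kernel D_d, that is the sum of cos (2 j t) over - d < j <= d, with the
    terms of index - j and j + 1 grouped together. *)
Fixpoint kern (d : nat) (t : R) : R :=
  if d is j.+1 then
    kern j t + (cos (j%:R * (2 * t)) + cos (j.+1%:R * (2 * t)))
  else 0.

Lemma kern_rec (d : nat) t :
  kern d.+2 t + kern d t = 2 * cos (2 * t) * kern d.+1 t.
Proof.
have cosS (j : nat) : cos (j.+2%:R * (2 * t)) + cos (j%:R * (2 * t)) =
    2 * cos (2 * t) * cos (j.+1%:R * (2 * t)).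
  have -> : j.+2%:R * (2 * t) = j.+1%:R * (2 * t) + 2 * t.
    by rewrite -[j.+2%:R]natr1; ring.
  have -> : j%:R * (2 * t) = j.+1%:R * (2 * t) - 2 * t.
    by rewrite -[j.+1%:R]natr1; ring.
  by rewrite cosD cosB; ring.
elim: d => [|d IH] /=.
  by have := cosS 0%N; rewrite !mul0r !mul1r cos0 => ?; nra.
have := cosS d; have := cosS d.+1; move: IH => /=; lra.
Qed.

(** For fixed [t], the function [d |-> kern d t] is an eigenfunction of each
    step of the killed walk. *)
Lemma kern_lazy_step (b : R) (d : nat) t :
  lazy_step b (kern^~ t) d = (1 - 4 * (b * (1 - b)) * sin t ^+ 2) * kern d t.
Proof.
case: d => [|d]; first by rewrite /= mulr0.
have := kern_rec d t; have -> : cos (2 * t) = 1 - 2 * sin t ^+ 2.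
  by rewrite mulrC mulr_natr cos_mulr2n cos2sin2; ring.
rewrite /lazy_step /coin.
move: (kern d.+2 t) (kern d.+1 t) (kern d t) => p q r E.
have -> : p = 2 * (1 - 2 * sin t ^+ 2) * q - r by lra.
ring.
Qed.

Lemma continuous_cosM (c : R) : continuous (fun t => cos (c * t)).
Proof.
move=> t; apply: continuous_comp; first exact: mulrl_continuous.
exact: continuous_cos.
Qed.

Lemma continuous_kern d : continuous (kern d).
Proof.
elim: d => [|d IH] t /=; first exact: cvg_cst.
apply: cvgD; first exact: IH.
under eq_fun do rewrite !mulrA.
by rewrite !mulrA; apply: cvgD; exact: continuous_cosM.
Qed.


Lemma mean_kern d : mean (kern d) = alive d.
Proof.
elim: d => [|d IH]; first exact: mean0.
have cc (c : R) : continuous (fun t => cos (c * (2 * t))).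
  by under eq_fun do rewrite mulrA; exact: continuous_cosM.
rewrite /= meanD; last 2 first.
- exact: continuous_kern.
- by move=> t; apply: cvgD; exact: cc.
rewrite meanD// mean_cos addr0 IH; case: d {IH} => [|d].
  by rewrite add0r; under eq_fun do rewrite mul0r cos0; exact: mean1.
by rewrite mean_cos addr0.
Qed.

(** The product of the eigenvalues at [t] of the steps of levels [i + 1, ..., m]. *)
Definition weight (a : nat -> R) (i m : nat) (t : R) : R :=
  \prod_(i.+1 <= k < m.+1) (1 - 4 * (a k * (1 - a k)) * sin t ^+ 2).

Lemma weight_factor_ge0 (b t : R) : 0 <= b <= 1 ->
  0 <= 1 - 4 * (b * (1 - b)) * sin t ^+ 2.
Proof.
move=> b01; have := sin2cos2 t; have := sqr_ge0 (sin t).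
have := sqr_ge0 (cos t); have := sqr_ge0 (1 - 2 * b); nra.
Qed.

Lemma continuous_weight a i m : continuous (weight a i m).
Proof.
move=> t; rewrite /weight; apply: cvg_big => [|k _].
  exact: mul_continuous.
apply: cvgB; first exact: cvg_cst.
apply: cvgM; first exact: cvg_cst.
by apply: cvgM; exact: continuous_sin.
Qed.

Lemma mean_lazy_step (w : R -> R) (b : R) (d : nat) : continuous w ->
  lazy_step b (fun d => mean (fun t => w t * kern d t)) d =
  mean (fun t => w t * lazy_step b (kern^~ t) d).
Proof.
move=> cw; case: d => [|d].
  rewrite [LHS]/= -mean0; congr mean.
  by apply/funext => t; rewrite mulr0.
have cwk (n : nat) : continuous (fun t => w t * kern n t).
  by move=> t; apply: cvgM; [exact: cw|exact: continuous_kern].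
have cZ (c : R) (n : nat) : continuous (fun t => c * (w t * kern n t)).
  by move=> t; apply: cvgM; [exact: cvg_cst|exact: cwk].
rewrite (_ : (fun t => w t * _) = fun t =>
    ((1 - b) ^+ 2 + b ^+ 2) * (w t * kern d.+1 t) +
    (b * (1 - b) * (w t * kern d.+2 t) + b * (1 - b) * (w t * kern d t))).
  rewrite meanD//; last by move=> t; apply: cvgD; exact: cZ.
  by rewrite meanD// !meanZ// /lazy_step /coin; ring.
by apply/funext => t; rewrite /lazy_step /coin; ring.
Qed.

Lemma survival_mean a i m d : (i <= m)%N ->
  survival a i m d = mean (fun t => weight a i m t * kern d t).
Proof.
elim: m d => [|m IH] d.
  rewrite leqn0 => /eqP ->; rewrite survival_id -mean_kern; congr mean.
  by apply/funext => t; rewrite /weight big_geq// mul1r.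
rewrite leq_eqVlt => /predU1P[->|im].
  rewrite survival_id -mean_kern; congr mean.
  by apply/funext => t; rewrite /weight big_geq// mul1r.
rewrite survivalSn//.
have -> : survival a i m = fun d => mean (fun t => weight a i m t * kern d t).
  by apply/funext => e; rewrite IH.
rewrite mean_lazy_step; last exact: continuous_weight.
apply: (congr1 mean); apply/funext => t.
by rewrite kern_lazy_step [LHS]mulrA /weight [in RHS]big_nat_recr//=.
Qed.

(** * Gaussian bound for the survival probability *)

(** After the substitution [u = c * sin t] this is a truncated Gaussian
    integral. *)
Lemma mean_gauss (c : R) : 0 < c ->
  mean (fun t => gauss_fun (c * sin t) * (c * cos t)) <= (Num.sqrt pi)^-1.
Proof.
move=> c0; have pi0 := @pi_gt0 R.
have dF (t : R) : is_derive t 1 (fun t => c * sin t) (c * cos t).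
  exact: is_deriveZ.
have F' : derive1 (fun t => c * sin t) = (fun t => c * cos t).
  by apply/funext => t; rewrite derive1E; exact: derive_val.
have cF' : continuous (fun t => c * cos t).
  by move=> t; apply: cvgM; [exact: cvg_cst|exact: continuous_cos].
have cF : continuous (fun t => c * sin t).
  by move=> t; apply: cvgM; [exact: cvg_cst|exact: continuous_sin].
have := @integration_by_substitution_increasing R (fun t => c * sin t)
  gauss_fun 0 (pi / 2).
rewrite F' sin0 mulr0 sin_pihalf mulr1 => subst.
have {}subst : (\int[lebesgue_measure]_(x in `[0%R, c]) (gauss_fun x)%:E =
   \int[lebesgue_measure]_(t in `[0%R, (pi / 2)%R])
      (gauss_fun (c * sin t) * (c * cos t))%:E)%E.
  apply: subst.
  - by rewrite divr_ge0 ?pi_ge0.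
  - move=> x y; rewrite !in_itv/= => /andP[x0 xp] /andP[y0 yp] xy.
    by rewrite ltr_pM2l// ltr_sin// in_itv/=; apply/andP; split=> //; lra.
  - by move=> t _; exact: cF'.
  - by apply/cvg_ex; exists (c * cos 0); apply: cvg_at_right_filter; exact: cF'.
  - by apply/cvg_ex; eexists; apply: cvg_at_left_filter; exact: cF'.
  - split; first by move=> t _.
      by apply: cvg_at_right_filter; exact: cF.
    by apply: cvg_at_left_filter; exact: cF.
  - exact/continuous_subspaceT/continuous_gauss_fun.
rewrite /mean /Rintegral -subst.
have le_half : (\int[lebesgue_measure]_(x in `[0%R, c]) (gauss_fun x)%:E <=
    (Num.sqrt pi / 2 : R)%:E)%E.
  rewrite -integral0y_gauss; apply: ge0_subset_integral => //=.
  - by apply/measurable_EFinP/measurable_funTS; exact: measurable_gauss_fun.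
  - by move=> t _; rewrite lee_fin gauss_fun_ge0.
  - by move=> t /=; rewrite !in_itv/= andbT => /andP[].
have {}le_half : fine (\int[lebesgue_measure]_(x in `[0%R, c])
    (gauss_fun x)%:E)%E <= Num.sqrt pi / 2.
  rewrite -lee_fin fineK// ge0_fin_numE ?(le_lt_trans le_half) ?ltry//.
  by apply: integral_ge0 => t _; rewrite lee_fin gauss_fun_ge0.
apply: (@le_trans _ _ (2 / pi * (Num.sqrt pi / 2))).
  by rewrite ler_wpM2l// divr_ge0// ltW.
have s0 : 0 < Num.sqrt (pi : R) by rewrite sqrtr_gt0.
rewrite -{1}(sqr_sqrtr (ltW pi0)).
by rewrite le_eqVlt; apply/orP; left; apply/eqP; field; rewrite gt_eqF.
Qed.

Lemma survival_le_sqrt (a : nat -> R) (i n : nat)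
    (s := \sum_(i.+1 <= k < n.+1) a k * (1 - a k)) :
  (i <= n)%N -> (forall k, (1 <= k)%N -> 0 <= a k <= 1) -> 0 < s ->
  survival a i n 1 <= (Num.sqrt (pi * s))^-1.
Proof.
move=> le_in a01 s0; rewrite survival_mean//.
(* With this c, 4 s (sin t)^2 is the square of c sin t. *)
set c := 2 * Num.sqrt s.
have c0 : 0 < c by rewrite mulr_gt0// sqrtr_gt0.
have c2 : c ^+ 2 = 4 * s by rewrite exprMn sqr_sqrtr 1?ltW//; ring.
pose h t := gauss_fun (c * sin t) * (c * cos t).
have ch : continuous h.
  move=> t; apply: cvgM.
    apply: continuous_comp; last exact: continuous_gauss_fun.
    by apply: cvgM; [exact: cvg_cst|exact: continuous_sin].
  by apply: cvgM; [exact: cvg_cst|exact: continuous_cos].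
apply: (@le_trans _ _ (mean (fun t => 2 / c * h t))).
  apply: le_mean.
  - move=> t; apply: cvgM; [exact: continuous_weight|exact: continuous_kern].
  - by move=> t; apply: cvgM; [exact: cvg_cst|exact: ch].
  move=> t /andP[t0 tpi].
  have cost0 : 0 <= cos t by rewrite cos_ge0_pihalf//; apply/andP; split; lra.
  have -> : kern 1 t = 2 * cos t ^+ 2.
    rewrite /= mul0r cos0 mul1r add0r [2 * t]mulrC mulr_natr cos_mulr2n.
    ring.
  have -> : 2 / c * h t = gauss_fun (c * sin t) * (2 * cos t).
    by rewrite /h; field; rewrite gt_eqF.
  apply: ler_pM.
  - rewrite /weight big_nat prodr_ge0// => k /andP[ik _].
    by rewrite weight_factor_ge0// a01// (leq_trans _ ik).
  - by rewrite mulr_ge0// sqr_ge0.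
  - rewrite /gauss_fun exprMn c2 /s.
    rewrite mulr_sumr mulr_suml -sumrN expR_sum /weight !big_nat.
    apply: ler_prod => k /andP[ik _]; rewrite weight_factor_ge0 ?a01//=.
      exact: expR_ge1Dx.
    exact: leq_trans ik.
  - have := cos_le1 t; nra.
rewrite meanZ// (le_trans (ler_wpM2l _ (mean_gauss _ c0)))//.
  by rewrite divr_ge0// ltW.
rewrite sqrtrM ?pi_ge0// invfM /c invfM mulrA divff// mul1r.
by rewrite mulrC.
Qed.

End kernel.

(** * The rate function *)

Section rate.
Context {R : realType}.
Implicit Types (a e : nat -> R).

Lemma sigma_ge0 (y : R) : 0 <= sigma y.
Proof. by rewrite /sigma; case: ifP => // _; rewrite le_min ler01/= invr_ge0. Qed.

Lemma sigma_le1 (y : R) : sigma y <= 1.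
Proof. by rewrite /sigma; case: ifP => // _; rewrite ge_min lexx. Qed.

Lemma sigma_lt (y eps : R) : 0 < eps -> (pi * eps ^+ 2)^-1 < y ->
  sigma y < eps.
Proof.
move=> eps0 yeps; have pi0 := @pi_gt0 R.
have pe0 : 0 < pi * eps ^+ 2 by rewrite mulr_gt0// exprn_gt0.
have y0 : 0 < y by rewrite (lt_trans _ yeps)// invr_gt0.
rewrite /sigma gt_eqF// gt_min; apply/orP; right.
rewrite invf_plt ?posrE ?sqrtr_gt0 ?mulr_gt0//.
rewrite -(ltr_pXn2r (ltn0Sn 1)) ?nnegrE ?invr_ge0 ?sqrtr_ge0 ?ltW//.
rewrite sqr_sqrtr; last by rewrite mulr_ge0 ?ltW.
by rewrite exprVn; move: yeps; rewrite invfM -ltr_pdivrMl// mulrC.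
Qed.

Lemma tauB a i n : (i <= n)%N ->
  tau a n - tau a i = \sum_(i.+1 <= k < n.+1) a k * (1 - a k).
Proof.
move=> le_in; rewrite /tau [X in X - _](@big_cat_nat _ _ _ i.+1)//=.
by rewrite [X in X - _]addrC addrK.
Qed.

Lemma survival_le_sigma a i n : (i <= n)%N ->
  (forall k, (1 <= k)%N -> 0 <= a k <= 1) ->
  survival a i n 1 <= sigma (tau a n - tau a i).
Proof.
move=> le_in a01; have s1 : survival a i n 1 <= 1.
  by have /andP[] := survival_itv01 a i n a01 1%N.
rewrite /sigma; case: eqP => // /eqP t0.
rewrite le_min s1 tauB// survival_le_sqrt// -tauB// lt_neqAle eq_sym t0/= tauB//.
rewrite big_nat sumr_ge0// => k /andP[ik _].
have /a01 : (1 <= k)%N by exact: leq_trans ik.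
by move=> ?; rewrite mulr_ge0; lra.
Qed.

Lemma race_bound_le_sigma a e (kappa : R) n : 0 <= kappa ->
  (forall k, (1 <= k)%N -> 0 <= a k <= 1) ->
  (forall k, (1 <= k)%N -> 0 <= e k) ->
  race_bound a e kappa n 0 1 <= kappa * sigma (tau a n) +
    \sum_(1 <= i < n.+1) 2 * e i * sigma (tau a n - tau a i).
Proof.
move=> kappa0 a01 e0; rewrite /race_bound addn0 [X in _ + X <= _]big_geq// addr0.
have tau0 : tau a 0 = 0 by rewrite /tau big_geq.
apply: lerD.
  by rewrite ler_wpM2l// -[tau a n]subr0 -tau0 survival_le_sigma.
apply: ler_sum_nat => i /andP[i1 i_n].
by rewrite ler_wpM2l ?mulr_ge0 ?e0// survival_le_sigma.
Qed.

Lemma sigma_tau_cvg0 a i : tau a @ \oo --> +oo ->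
  sigma (tau a n - tau a i) @[n --> \oo] --> (0 : R).
Proof.
move=> tauy; apply/cvgr0Pnorm_lt => eps eps0.
move/cvgryPgt : tauy => /(_ ((pi * eps ^+ 2)^-1 + tau a i)).
apply: filterS => n; rewrite -ltrBrDr => /(sigma_lt _ _ eps0).
by rewrite ger0_norm// sigma_ge0.
Qed.

(** Discrete dominated convergence: the tail of the sum is small uniformly in
    [n] because sigma is at most 1, and each of the remaining finitely many
    terms tends to 0. *)
Lemma sum_sigma_cvg0 a e (S : R) :
  (forall k, (1 <= k)%N -> 0 <= e k) ->
  (forall n, \sum_(1 <= i < n) e i <= S) ->
  tau a @ \oo --> +oo ->
  \sum_(1 <= i < n.+1) 2 * e i * sigma (tau a n - tau a i) @[n --> \oo] -->
    (0 : R).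
Proof.
move=> e0 eS tauy.
pose s n := \sum_(1 <= i < n.+1) e i.
have s_nd : {homo s : n m / (n <= m)%N >-> n <= m}.
  move=> n m nm; rewrite /s [leRHS](@big_cat_nat _ _ _ n.+1)//= lerDl.
  rewrite big_nat sumr_ge0// => k /andP[nk _]; apply: e0.
  exact: leq_trans nk.
have s_cvg : cvgn s.
  by apply: nondecreasing_is_cvgn => //; exists S => _ [n _ <-]; exact: eS.
apply/cvgr0Pnorm_lt => eps eps0.
have [N sN] : exists N, limn s - s N < eps / 4.
  have /cvgrPdist_lt/(_ (eps / 4)) : s n @[n --> \oo] --> limn s by exact: s_cvg.
  case=> [|N _ /(_ N)]; first by rewrite divr_gt0.
  move=> /(_ (leqnn N)) sN; exists N.
  by rewrite (le_lt_trans _ sN)// ler_norm.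
have head_cvg : \sum_(1 <= i < N.+1) 2 * e i * sigma (tau a n - tau a i)
    @[n --> \oo] --> (0 : R).
  rewrite [X in _ --> X](_ : _ = \sum_(1 <= i < N.+1) 2 * e i * 0).
    apply: cvg_big => [|i _]; first exact: add_continuous.
    by apply: cvgM; [exact: cvg_cst|exact: sigma_tau_cvg0].
  by rewrite big1// => i _; rewrite mulr0.
have sum_ge0 (m p n : nat) :
    0 <= \sum_(m.+1 <= i < p) 2 * e i * sigma (tau a n - tau a i).
  rewrite big_nat sumr_ge0// => i /andP[mi _].
  by rewrite mulr_ge0 ?sigma_ge0// mulr_ge0// e0// (leq_trans _ mi).
have half_eps : 0 < eps / 2 by rewrite divr_gt0.
move/cvgr0Pnorm_lt : head_cvg => /(_ _ half_eps) head_lt.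
near=> n; rewrite ger0_norm//.
have Nn : (N <= n)%N by near: n; exact: nbhs_infty_ge.
have : `|\sum_(1 <= i < N.+1) 2 * e i * sigma (tau a n - tau a i)| < eps / 2.
  by near: n.
rewrite ger0_norm// => headn; rewrite (@big_cat_nat _ _ _ N.+1)//=.
suff : \sum_(N.+1 <= i < n.+1) 2 * e i * sigma (tau a n - tau a i) < eps / 2.
  by move=> ?; lra.
apply: (@le_lt_trans _ _ (2 * (s n - s N))).
  rewrite /s [X in X - _](@big_cat_nat _ _ _ N.+1)//= [X in X - _]addrC addrK.
  rewrite mulr_sumr.
  rewrite !big_nat; apply: ler_sum => i /andP[Ni _].
  by rewrite ler_piMr ?sigma_le1// mulr_ge0// e0// (leq_trans _ Ni).
have := nondecreasing_cvgn_le s_nd s_cvg n; lra.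
Unshelve. all: by end_near. Qed.

End rate.

(** * The iteration *)

Section iteration.
Context {R : realType}.

Lemma uniform_limit_nonexpansive (X : normedModType R) (C : set X)
    (T_ : nat -> X -> X) (T : X -> X) :
  (forall n : nat, (1 <= n)%N -> nonexpansive_on C (T_ n)) ->
  {uniform C, T_ @ \oo --> T} -> nonexpansive_on C T.
Proof.
move=> neT_ cvT y z Cy Cz.
have cvgT w : C w -> T_ n w @[n --> \oo] --> T w.
  move=> Cw; have : {uniform [set w], T_ @ \oo --> T}.
    by apply: uniform_subset_cvg cvT => _ ->.
  by rewrite uniform_set1.
have cvgn : `|T_ n y - T_ n z| @[n --> \oo] --> `|T y - T z|.
  by apply: cvg_norm; apply: cvgB; exact: cvgT.
apply: (cvgr_to_le cvgn); near=> n; apply: neT_ => //.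
by near: n; exact: nbhs_infty_ge.
Unshelve. all: by end_near. Qed.

Lemma convex_set_comb (X : normedModType R) (C : set X) (b : R) (y z : X) :
  convex_set C -> 0 <= b <= 1 -> C y -> C z -> C ((1 - b) *: y + b *: z).
Proof.
move=> cC /andP[b0 b1] Cy Cz.
have := cC z y (Itv01 b0 b1); rewrite !inE => /(_ Cz Cy).
by rewrite /conv/= addrC.
Qed.

End iteration.

(** Here [w] is the exact image that [z] approximates. *)
Lemma norm_sub_comb_le {R : realType} (X : normedModType R) (b : R)
    (p y z w : X) : 0 <= b <= 1 ->
  `|p - ((1 - b) *: y + b *: z)| <=
  (1 - b) * `|p - y| + b * `|p - w| + b * `|z - w|.
Proof.
move=> /andP[b0 b1].
have -> : p - ((1 - b) *: y + b *: z) =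
    (1 - b) *: (p - y) + b *: (p - w) + b *: (w - z).
  rewrite -addrA -scalerDr subrKA !scalerBr addrACA -scalerDl subrK scale1r.
  by rewrite opprD.
rewrite (le_trans (ler_normD _ _))//; apply: lerD.
  rewrite (le_trans (ler_normD _ _))// !normrZ !ger0_norm//.
  by rewrite subr_ge0.
by rewrite normrZ ger0_norm// distrC.
Qed.

Lemma tau_cvgy {R : realType} (a : nat -> R) :
  (forall n : nat, (1 <= n)%N -> 0 <= a n <= 1) ->
  (\sum_(1 <= k <oo) (a k * (1 - a k))%:E = +oo)%E ->
  tau a @ \oo --> +oo.
Proof.
move=> a01 sum_oo.
have cvg_oo : (\sum_(1 <= k < n) (a k * (1 - a k))%:E)%E @[n --> \oo] --> +oo%E.
  rewrite -sum_oo; apply: is_cvg_ereal_nneg_natsum => k /a01 /andP[a0 a1].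
  by rewrite lee_fin mulr_ge0// subr_ge0.
apply/cvgryPge => A; move/cvgeyPge : cvg_oo => /(_ A) [N _ NA].
exists N => // n /= Nn; have /= := NA n.+1 (leq_trans Nn (leqnSn n)).
by rewrite sumEFin lee_fin.
Qed.

Theorem corollary4p6 (R : realType) (X : completeNormedModType R) (C : set X)
    (T_ : nat -> X -> X) (T : X -> X) (alpha : nat -> R) (x : nat -> X)
    (kappa : R)
    (rho := fun n : nat => unif_dist C (T_ n) T) :
  closed C ->
  convex_set C ->
  (forall n : nat, (1 <= n)%N -> forall y : X, C y -> C (T_ n y)) ->
  (forall n : nat, (1 <= n)%N -> nonexpansive_on C (T_ n)) ->
  (forall y : X, C y -> C (T y)) ->
  {uniform C, T_ @ \oo --> T} ->
  (forall n : nat, (1 <= n)%N -> 0 <= alpha n <= 1) ->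
  C (x 0%N) ->
  (forall n : nat,
    x n.+1 = (1 - alpha n.+1) *: x n + alpha n.+1 *: T_ n.+1 (x n)) ->
  (\sum_(1 <= k <oo) (alpha k)%:E * rho k < +oo)%E ->
  (\sum_(1 <= k <oo) (alpha k * (1 - alpha k))%:E = +oo)%E ->
  0 <= kappa ->
  (forall n : nat, `|x 0%N - T (x n)| <= kappa) ->
  (fun n : nat => `|x n - T (x n)|) @ \oo --> (0 : R) /\
  (forall n : nat,
    ((`|x n - T (x n)|)%:E <=
      (kappa * sigma (tau alpha n))%:E
      + \sum_(1 <= i < n.+1)
          2%:E * (alpha i)%:E * rho i * (sigma (tau alpha n - tau alpha i))%:E
      + 2%:E * rho n.+1)%E).
Proof.
move=> _ convC TC neT_ _ cvT a01 Cx0 xS sum_rho sum_oo kappa0 kappaP.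
have Cx n : C (x n).
  by elim: n => // n IH; rewrite xS; apply: convex_set_comb; auto.
have neT := uniform_limit_nonexpansive _ _ _ _ neT_ cvT.
have rho_ub n y : C y -> ((`|T_ n y - T y|)%:E <= rho n)%E.
  by move=> Cy; apply: ereal_sup_ubound; exists y.
have rho0 n : (0 <= rho n)%E.
  by apply: le_trans (rho_ub n _ Cx0); rewrite lee_fin.
have arho0 n : (1 <= n)%N -> (0 <= (alpha n)%:E * rho n)%E.
  by move=> /a01/andP[? _]; rewrite mule_ge0.
(* Where rho is infinite the step size vanishes, by summability, so that the
   default value 0 of fine is harmless. *)
pose e n := alpha n * fine (rho n).
have eE n : (1 <= n)%N -> ((alpha n)%:E * rho n = (e n)%:E)%E.
  move=> n1; have [an0|an0] := eqVneq (alpha n) 0.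
    by rewrite /e an0 mul0r mul0e.
  rewrite /e EFinM fineK// ge0_fin_numE// ltNge leye_eq; apply/eqP => rhoy.
  have : ((alpha n)%:E * rho n < +oo)%E.
    apply: le_lt_trans sum_rho.
    have := nneseries_lim_ge (P := xpredT) n.+1 (fun k k1 _ => arho0 k k1).
    apply: le_trans; rewrite big_nat_recr//= leeDr//.
    by rewrite big_nat sume_ge0// => k /andP[/arho0].
  rewrite rhoy gt0_muley ?ltxx// lte_fin lt_neqAle eq_sym an0.
  by case/andP: (a01 _ n1).
have e0 n : (1 <= n)%N -> 0 <= e n.
  by move=> n1; rewrite -lee_fin -eE// arho0.
have err n y : (1 <= n)%N -> C y -> alpha n * `|T_ n y - T y| <= e n.
  move=> n1 Cy; rewrite -lee_fin -eE// EFinM lee_wpmul2l ?rho_ub// lee_fin.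
  by case/andP: (a01 _ n1).
have bound n : `|x n - T (x n)| <= kappa * sigma (tau alpha n) +
    \sum_(1 <= i < n.+1) 2 * e i * sigma (tau alpha n - tau alpha i).
  apply: le_trans (race_bound_le_sigma alpha e kappa n kappa0 a01 e0).
  have [] // := race_bound_ge alpha e kappa
    (fun m k => `|x m - x (m + k)%N|) (fun m k => `|x m - T (x (m + k)%N)|)
    kappa0 a01 e0 _ _ _ _ n 0%N; last by rewrite addn0.
  - by move=> m; rewrite addn0 subrr normr0.
  - move=> m k; rewrite addnS xS; set N := (m + k)%N.
    apply: le_trans (norm_sub_comb_le _ _ _ _ _ (T (x N)) (a01 N.+1 isT)) _.
    by rewrite lerD2l err.
  - move=> m k; rewrite xS addSnnS; set N := (m + k.+1)%N.
    rewrite distrC.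
    apply: le_trans (norm_sub_comb_le _ _ _ _ _ (T (x m)) (a01 m.+1 isT)) _.
    rewrite lerD ?err// lerD//; first by rewrite distrC.
    rewrite distrC ler_wpM2l ?neT//.
    by case/andP: (a01 m.+1 isT).
split.
  have tauy := tau_cvgy _ a01 sum_oo.
  have [S eS] : exists S, forall n, \sum_(1 <= i < n) e i <= S.
    exists (fine (\sum_(1 <= k <oo) (alpha k)%:E * rho k)%E) => n.
    have sum_ge := nneseries_lim_ge (P := xpredT) n (fun k k1 _ => arho0 k k1).
    rewrite -lee_fin fineK.
      apply: le_trans sum_ge; rewrite -sumEFin !big_nat.
      by apply: lee_sum => k /andP[k1 _]; rewrite eE.
    rewrite ge0_fin_numE//; apply: nneseries_ge0 => k k1 _; exact: arho0.
  apply: (squeeze_cvgr (f := fun=> 0) (h := fun n => kappa * sigma (tau alpha n) +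
    \sum_(1 <= i < n.+1) 2 * e i * sigma (tau alpha n - tau alpha i))).
  - by apply: nearW => n; rewrite normr_ge0 bound.
  - exact: cvg_cst.
  - rewrite -[X in _ --> X]addr0; apply: cvgD.
      rewrite -[X in _ --> X](mulr0 kappa); apply: cvgM; first exact: cvg_cst.
      have := sigma_tau_cvg0 alpha 0 tauy.
      by under eq_fun do rewrite [tau alpha 0]big_geq// subr0.
    exact: sum_sigma_cvg0 eS tauy.
move=> n; have -> : (\sum_(1 <= i < n.+1)
      2%:E * (alpha i)%:E * rho i * (sigma (tau alpha n - tau alpha i))%:E)%E =
    (\sum_(1 <= i < n.+1) 2 * e i * sigma (tau alpha n - tau alpha i))%:E.
  rewrite -sumEFin !big_nat; apply: eq_bigr => i /andP[i1 _].
  by rewrite -[(2%:E * _ * _)%E]muleA eE// !EFinM.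
have := bound n; rewrite -lee_fin -EFinD => /le_trans; apply.
by rewrite leeDl// mule_ge0.
Qed.
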